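(* Let $X$ and $Y$ be mm-spaces. If $d_{\mathrm{Eur}}(X,Y)=0$, then $X$ and $Y$ are mm-isomorphic.
   Context: An mm-space is a complete separable metric space $(X,d_X)$ with a Borel probability measure $m_X$. $X$ and $Y$ are mm-isomorphic if there is an isometry $f:\operatorname{supp}m_X\to\operatorname{supp}m_Y$ with $f_*m_X=m_Y$. $\Pi(m_X,m_Y)$: Borel probability measures on $X\times Y$ with marginals $m_X,m_Y$. $\{|d_X-d_Y|>\varepsilon\}:=\{(x_1,y_1,x_2,y_2)\in X\times Y\times X\times Y:|d_X(x_1,x_2)-d_Y(y_1,y_2)|>\varepsilon\}$. $d_{\mathrm{Eur}}(X,Y):=\inf_{\pi\in\Pi(m_X,m_Y)}\inf_{\varepsilon\ge0}\max\{\varepsilon,(\pi\otimes\pi)(|d_X-d_Y|>\varepsilon)\}$. *)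

(* Defs.v *)
From HB Require Import structures.
From mathcomp Require Import all_boot all_order all_algebra.
From mathcomp Require Import all_classical all_reals all_analysis.
Set Implicit Arguments. Unset Strict Implicit. Unset Printing Implicit Defensive.
Import Order.TTheory GRing.Theory Num.Theory.
Local Open Scope classical_set_scope.
Local Open Scope ring_scope.

Section MM.
Variable R : realType.

Definition is_metric (T : Type) (d : T -> T -> R) : Prop :=
  [/\ forall x y, d x y = 0 <-> x = y,
      forall x y, d x y = d y x &
      forall x y z, d x z <= d x y + d y z].

Definition dball (T : Type) (d : T -> T -> R) (x : T) (r : R) : set T :=
  [set y | d x y < r].

Definition dopen (T : Type) (d : T -> T -> R) (A : set T) : Prop :=
  forall x, A x -> exists2 r, 0 < r & dball d x r `<=` A.

Definition dcomplete (T : Type) (d : T -> T -> R) : Prop :=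
  forall u : nat -> T,
    (forall e, 0 < e -> exists N, forall m n, (N <= m)%N -> (N <= n)%N -> d (u m) (u n) < e) ->
    exists x, forall e, 0 < e -> exists N, forall n, (N <= n)%N -> d (u n) x < e.

Definition dseparable (T : Type) (d : T -> T -> R) : Prop :=
  exists D : set T, countable D /\
    forall x e, 0 < e -> exists2 y, D y & d x y < e.

Definition is_mm_space (dx : measure_display) (X : measurableType dx)
  (d : X -> X -> R) (m : probability X R) : Prop :=
  [/\ is_metric d, dcomplete d, dseparable d &
      (@measurable _ X) = <<s [set A | dopen d A] >>].

Definition supp (dx : measure_display) (X : measurableType dx)
  (d : X -> X -> R) (m : probability X R) : set X :=
  [set x | forall r, 0 < r -> (0 < m (dball d x r))%E].

Definition mm_isomorphic (dx dy : measure_display)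
  (X : measurableType dx) (Y : measurableType dy)
  (dX : X -> X -> R) (mX : probability X R)
  (dY : Y -> Y -> R) (mY : probability Y R) : Prop :=
  exists f : X -> Y,
    [/\ f @` supp dX mX = supp dY mY,
        (forall x1 x2, supp dX mX x1 -> supp dX mX x2 -> dY (f x1) (f x2) = dX x1 x2) &
        (forall B, measurable B -> mY B = mX (supp dX mX `&` f @^-1` B))].

Definition couplings (dx dy : measure_display)
  (X : measurableType dx) (Y : measurableType dy)
  (mX : probability X R) (mY : probability Y R) : set (probability (X * Y)%type R) :=
  [set pi | (forall A, measurable A -> pi (A `*` setT) = mX A) /\
            (forall B, measurable B -> pi (setT `*` B) = mY B)].

Definition dist_gap (dx dy : measure_display)
  (X : measurableType dx) (Y : measurableType dy)
  (dX : X -> X -> R) (dY : Y -> Y -> R) (eps : R) : set ((X * Y) * (X * Y))%type :=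
  [set p | eps < `| dX p.1.1 p.2.1 - dY p.1.2 p.2.2 |].

Definition d_Eur (dx dy : measure_display)
  (X : measurableType dx) (Y : measurableType dy)
  (dX : X -> X -> R) (mX : probability X R)
  (dY : Y -> Y -> R) (mY : probability Y R) : \bar R :=
  ereal_inf [set v | exists pi eps, [/\ couplings mX mY pi, 0 <= eps &
      v = Order.max (eps%:E) (product_measure1 pi pi (dist_gap dX dY eps))]].

End MM.

(* Main.v *)
(* If d_Eur(X, Y) = 0, the sets of couplings pi with (pi x pi)(|dX - dY| > eps) <= eps
   are nonempty and generate a filter; let U be an ultrafilter refining it.  Declare
   x and y matched when, for all delta, pi{|dX(x, .) - dY(y, .)| > delta} tends to 0
   along U.  By Markov's inequality, a point x of supp mX has for U-many pi an
   approximate match y depending on pi; since all these y see a ball of mass bounded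
   below, they lie near finitely many points, so U selects approximate matches
   independent of pi, and these form a Cauchy sequence whose limit matches x.
   Matching is symmetric in X and Y, preserves distances and supports, hence is the
   graph of an isometry of the supports.  Covering an open set by countably many small
   balls around matched points shows that matched open sets have the same measure.
   No compactness of the set of couplings is needed. *)
Require Import Defs.
From HB Require Import structures.
From mathcomp Require Import all_boot all_order all_algebra.
From mathcomp Require Import all_classical all_reals all_analysis.
From mathcomp Require Import measurable_realfun lra.
Set Implicit Arguments.
Unset Strict Implicit.
Unset Printing Implicit Defensive.
Import Order.TTheory GRing.Theory Num.Theory.
Local Open Scope classical_set_scope.
Local Open Scope ring_scope.

Lemma natSinv_lt (R : realType) (e : R) : 0 < e -> exists k : nat, k.+1%:R^-1 < e.
Proof.
move=> e0; have [k _ H] := near_infty_natSinv_lt (PosNum e0).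
by exists k; exact: (H k (leqnn k)).
Qed.

(** * Probability estimates *)

Section probability_complements.
Context d (T : measurableType d) (R : realType).

Implicit Types P : probability T R.

Lemma probabilityU2 P A B :
  measurable A -> measurable B -> (P (A `|` B) <= P A + P B)%E.
Proof. exact: measureU2. Qed.

(** Turns mass estimates into points: it supplies the samples [w] that avoid small exceptional
    sets. *)
Lemma probability_lt_setD_neq0 P (A B : set T) :
  measurable A -> measurable B -> (P B < P A)%E -> (A `\` B) !=set0.
Proof.
move=> mA mB; apply: contraPP => /set0P/negP/negPn/eqP; rewrite setD_eq0 => AB.
by apply/negP; rewrite -leNgt le_measure// inE.
Qed.

Lemma probability_bigcup_gt P (F : (set T)^nat) c :
  (forall i, measurable (F i)) -> (c < P (\bigcup_i F i))%E ->
  exists N, (c < P (\bigcup_(i < N) F i))%E.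
Proof.
move=> mF; rewrite -bigcup_bigsetU_bigcup; set G := fun n => \big[setU/set0]_(i < n.+1) F i.
have mG i : measurable (G i) by exact: bigsetU_measurable.
move=> cG; apply: contrapT => /forallNP Nc.
have cv : P \o G @ \oo --> P (\bigcup_n G n).
  apply: nondecreasing_cvg_mu => //; first exact: bigcupT_measurable.
  by move=> i j ij; apply/subsetPset/subset_bigsetU.
move: cG; apply/negP; rewrite -leNgt -(cvg_lim _ cv)//.
(* [G n] unites the first [n.+1] sets, hence the index [n.+1]. *)
apply: lime_le; first by apply/cvg_ex; exists (P (\bigcup_n G n)).
apply: nearW => n; rewrite leNgt; apply/negP => cn; apply: (Nc n.+1).
by move: cn; rewrite /= /G bigcup_mkord.
Qed.

End probability_complements.

(** * Measurability, covering by balls and supports in an mm-space *)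

Section mm_space.
Context (R : realType) dx (X : measurableType dx).
Variables (d : X -> X -> R) (m : probability X R).
Hypothesis mmX : is_mm_space d m.

Lemma mm_dist_xx x : d x x = 0.
Proof. by case: mmX => -[H _ _] _ _ _; apply/H. Qed.

Lemma mm_dist_sym x y : d x y = d y x.
Proof. by case: mmX => -[_ H _] _ _ _. Qed.

Lemma mm_dist_triangle x y z : d x z <= d x y + d y z.
Proof. by case: mmX => -[_ _ H] _ _ _. Qed.

Lemma mm_dist_eq0 x y : d x y = 0 -> x = y.
Proof. by case: mmX => -[H _ _] _ _ _ /H. Qed.

Lemma dopen_dball x r : dopen d (dball d x r).
Proof.
move=> y /= xy; exists (r - d x y); first by rewrite subr_gt0.
move=> z /= yz; have := mm_dist_triangle x y z; rewrite /dball/= in xy yz *; lra.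
Qed.

Lemma measurable_dopen A : dopen d A -> measurable A.
Proof. by move=> oA; case: mmX => _ _ _ ->; exact: sub_sigma_algebra. Qed.

Lemma measurable_dball x r : measurable (dball d x r).
Proof. exact/measurable_dopen/dopen_dball. Qed.

Lemma measurable_dist x : measurable_fun setT (d x).
Proof.
apply: (measurability _ (RGenInftyO.measurableE R)) => _ [_ [r ->] <-].
rewrite setTI (_ : _ @^-1` _ = dball d x r); first exact: measurable_dball.
by apply/seteqP; split => y; rewrite /= in_itv/=.
Qed.

Lemma mm_dense_seq : exists z : nat -> X, forall x e, 0 < e -> exists n, d (z n) x < e.
Proof.
case: mmX => _ _ [D [cD dD]] _.
have [y Dy _] := dD point _ ltr01.
have /pfcard_geP[D0|[z]] := cD; first by rewrite D0 in Dy.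
exists z => x e e0; have [t Dt xt] := dD x e e0; have [n _ znt] := @surj _ _ _ _ z _ Dt.
by exists n; rewrite mm_dist_sym znt.
Qed.

(** Separability puts [d] in reach of the product sigma-algebra: [d x y < r] iff
    [d (z n) x + d (z n) y < r] for some term [z n] of a dense sequence. *)
Lemma measurable_dist2 : measurable_fun setT (fun p : X * X => d p.1 p.2).
Proof.
have [z dz] := mm_dense_seq.
apply: (measurability _ (RGenInftyO.measurableE R)) => _ [_ [r ->] <-].
rewrite setTI (_ : _ @^-1` _ =
    \bigcup_n ((fun p : X * X => d (z n) p.1 + d (z n) p.2) @^-1` `]-oo, r[)).
  apply: bigcupT_measurable => n; rewrite -[_ @^-1` _]setTI.
  apply: (_ : measurable_fun setT _) => //.
  apply: measurable_funD.
    exact: (measurableT_comp (@measurable_dist (z n)) measurable_fst).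
  exact: (measurableT_comp (@measurable_dist (z n)) measurable_snd).
apply/seteqP; split => -[x y]; rewrite /= in_itv/=.
  move=> xyr; have [|n zn] := dz x ((r - d x y) / 2); first by lra.
  exists n => //=; rewrite in_itv/=.
  rewrite (mm_dist_sym (z n) x) in zn *.
  by have := mm_dist_triangle (z n) x y; rewrite (mm_dist_sym (z n) x); lra.
move=> [n _] /=; rewrite in_itv/=; have := mm_dist_triangle x (z n) y.
by rewrite (mm_dist_sym x (z n)); lra.
Qed.

(** For each pair of a dense point [z i] and a scale [k], keep one point [y] of [S] within [1/(k+1)]
    of [z i] with [rho y] at least [2/(k+1)], if there is one. Its ball contains every other such
    point. *)
Lemma lindelof_dball (S : set X) (rho : X -> R) :
  S !=set0 -> (forall x, S x -> 0 < rho x) ->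
  exists u : nat -> X, (forall n, S (u n)) /\
    S `<=` \bigcup_n dball d (u n) (rho (u n)).
Proof.
move=> [x0 Sx0] rho0; have [z dz] := mm_dense_seq.
pose P (ik : nat * nat) x :=
  S x /\ d (z ik.1) x < ik.2.+1%:R^-1 /\ 2 * ik.2.+1%:R^-1 <= rho x.
(* The default [x0] keeps [f] in [S] on pairs that no point satisfies. *)
have /choice[f Pf] : forall ik, exists y, S y /\ ((exists x, P ik x) -> P ik y).
  move=> ik; have [[x Px]|nP] := pselect (exists x, P ik x).
    by exists x; split => //; case: Px.
  by exists x0; split => // /nP.
pose g n := odflt (0, 0)%N (unpickle n : option (nat * nat)).
exists (f \o g); split => [n|x Sx]; first by case: (Pf (g n)).
have [k kr] := natSinv_lt (divr_gt0 (rho0 _ Sx) (ltr0Sn R 1)).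
have kr2 : 2 * k.+1%:R^-1 <= rho x by rewrite -ler_pdivlMl// mulrC ltW.
have [i ix] := dz x k.+1%:R^-1 ltac:(by rewrite invr_gt0).
exists (pickle (i, k)) => //=; rewrite /g pickleK/=.
have [|_ [zf fr]] := (Pf (i, k)).2.
  by exists x.
move: zf fr => /=; set y := f _; rewrite /dball/= => zf fr.
move: (k.+1%:R^-1) kr2 zf fr ix {kr} => c kr2 zf fr ix.
by have := mm_dist_triangle y (z i) x; rewrite (mm_dist_sym y (z i)); lra.
Qed.

Lemma dopen_setC_supp : dopen d (~` supp d m).
Proof.
move=> x; rewrite /supp/= => /existsNP[r /not_implyP[r0 /negP]].
rewrite -leNgt measure_le0 => /eqP mr0.
exists r => // y xy /(_ (r - d x y)).
rewrite subr_gt0 => /(_ xy); apply/negP; rewrite -leNgt -mr0.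
rewrite le_measure ?inE//; [exact: measurable_dball..|].
move=> t; rewrite /dball/= => yt; have := mm_dist_triangle x y t; lra.
Qed.

Lemma measurable_supp : measurable (supp d m).
Proof. rewrite -(setCK (supp d m)); exact/measurableC/measurable_dopen/dopen_setC_supp. Qed.

(** Each point off the support has a null ball, and countably many of these cover the complement. *)
Lemma supp_full : m (~` supp d m) = 0%E.
Proof.
have mC : measurable (~` supp d m) by exact/measurableC/measurable_supp.
have [->|/set0P CN0] := eqVneq (~` supp d m) set0; first exact: measure0.
have /choice[rho rhoP] : forall x, exists r, ~ supp d m x -> 0 < r /\ m (dball d x r) = 0%E.
  move=> x; have [sx|] := pselect (supp d m x); first by exists 0.
  rewrite {1}/supp/= => /existsNP[r /not_implyP[r0 /negP]].
  by rewrite -leNgt measure_le0 => /eqP mr0; exists r.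
have [x /rhoP[]//|u [uS uC]] := lindelof_dball CN0 (rho := rho).
apply/negligibleP => //; apply: negligibleS uC _; apply: negligible_bigcup => n.
by apply/negligibleP; [exact: measurable_dball|case: (rhoP _ (uS n))].
Qed.

Lemma measure_setI_supp A : measurable A -> m (supp d m `&` A) = m A.
Proof.
move=> mA; rewrite [RHS](measureDI _ mA measurable_supp) setIC.
rewrite [X in (X + _)%E](_ : _ = 0%E) ?add0e//.
apply/eqP; rewrite -measure_le0 -supp_full le_measure// inE.
- exact: measurableD measurable_supp.
- exact/measurableC/measurable_supp.
Qed.

End mm_space.

(** * Ultrafilters of couplings and the matching relation *)

Lemma ultra_bigcup T (U : set_system T) (F : nat -> set T) N :
  UltraFilter U -> U (\bigcup_(i < N) F i) -> exists2 i, (i < N)%N & U (F i).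
Proof.
move=> UF; elim: N => [|N IH] UF_.
  by have [t [i]] := filter_ex UF_.
(* Either [F N] is in [U], or its complement is and the first [N] sets suffice. *)
have [UFN|UFN] := in_ultra_setVsetC (F N) UF; first by exists N.
have [|i iN Fi] := IH.
  apply: filterS (filterI UF_ UFN) => t [[i /= iN Fi] nFN]; exists i => //=.
  by move: iN; rewrite ltnS leq_eqVlt => /predU1P[iE|//]; move: nFN; rewrite -iE.
by exists i => //; exact: ltnW.
Qed.

(* Couplings are measures on an abstract [W] carrying the two projections [p] and
   [q], rather than on [X * Y], so that exchanging the roles of [X] and [Y] only
   amounts to exchanging [p] and [q]. *)
Section near_couplings.
Context (R : realType) dx dy dw (X : measurableType dx) (Y : measurableType dy)
  (W : measurableType dw).
Implicit Types (p : W -> X) (q : W -> Y) (U : set_system (probability W R)).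

Definition marginals (mX : probability X R) (mY : probability Y R) p q :
    set (probability W R) :=
  [set pi | (forall A, measurable A -> pi (p @^-1` A) = mX A) /\
            (forall B, measurable B -> pi (q @^-1` B) = mY B)].

Definition distortion_gap (dX : X -> X -> R) (dY : Y -> Y -> R) p q (eps : R) :
    set (W * W) :=
  [set w | eps < `|dX (p w.1) (p w.2) - dY (q w.1) (q w.2)|].

Definition vanishing_distortion (dX : X -> X -> R) (mX : probability X R)
    (dY : Y -> Y -> R) (mY : probability Y R) p q U : Prop :=
  forall eps : R, 0 < eps -> U [set pi | marginals mX mY p q pi /\
    (product_measure1 pi pi (distortion_gap dX dY p q eps) <= eps%:E)%E].

Definition gap (dX : X -> X -> R) (dY : Y -> Y -> R) p q x y (eps : R) : set W :=
  [set w | eps < `|dX x (p w) - dY y (q w)|].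

Definition asymptotically_null U (B : set W) : Prop :=
  forall e : R, 0 < e -> U [set pi | (pi B <= e%:E)%E].

(** Convergence in probability along [U]: the distance functions from [x] and from [y] agree in the
    limit. *)
Definition asymptotic_match (dX : X -> X -> R) (dY : Y -> Y -> R) p q U x y : Prop :=
  forall e : R, 0 < e -> asymptotically_null U (gap dX dY p q x y e).

End near_couplings.

Section swap.
Context (R : realType) dx dy dw (X : measurableType dx) (Y : measurableType dy)
  (W : measurableType dw).
Variables (dX : X -> X -> R) (mX : probability X R).
Variables (dY : Y -> Y -> R) (mY : probability Y R).
Variables (p : W -> X) (q : W -> Y) (U : set_system (probability W R)).

(** With [asymptotic_matchC], this allows the results on matching to be applied with [X] and [Y]
    exchanged, for the same [U]. *)
Lemma vanishing_distortionC : Filter U ->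
  vanishing_distortion dX mX dY mY p q U -> vanishing_distortion dY mY dX mX q p U.
Proof.
move=> FU H e e0; apply: filterS (H e e0) => pi [[pX pY] le_e]; split => //.
apply: le_trans le_e; rewrite le_eqVlt; apply/orP; left; apply/eqP.
by congr (product_measure1 _ _ _); apply/seteqP; split => w; rewrite /distortion_gap/= distrC.
Qed.

Lemma asymptotic_matchC x y :
  asymptotic_match dX dY p q U x y -> asymptotic_match dY dX q p U y x.
Proof.
move=> H e e0; rewrite (_ : gap _ _ _ _ _ _ _ = gap dX dY p q x y e); first exact: H.
by apply/seteqP; split => w; rewrite /gap/= distrC.
Qed.

End swap.

(** * Existence of matches, and their effect on distances, supports and measures *)

Section matching.
Context (R : realType) dx dy dw (X : measurableType dx) (Y : measurableType dy)
  (W : measurableType dw).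
Variables (dX : X -> X -> R) (mX : probability X R).
Variables (dY : Y -> Y -> R) (mY : probability Y R).
Variables (p : W -> X) (q : W -> Y) (U : set_system (probability W R)).
Hypothesis mmX : is_mm_space dX mX.
Hypothesis mmY : is_mm_space dY mY.
Hypothesis mp : measurable_fun setT p.
Hypothesis mq : measurable_fun setT q.
Hypothesis UF : UltraFilter U.
Hypothesis vanU : vanishing_distortion dX mX dY mY p q U.

Local Notation gap := (gap dX dY p q).
Local Notation match_ := (asymptotic_match dX dY p q U).

Lemma measurable_preimage_dball_l x r : measurable (p @^-1` dball dX x r).
Proof. by rewrite -[_ @^-1` _]setTI; apply: mp => //; exact: measurable_dball mmX _ _. Qed.

Lemma measurable_gap x y e : measurable (gap x y e).
Proof.
rewrite (_ : gap x y e = (fun w => `|dX x (p w) - dY y (q w)|) @^-1` `]e, +oo[); last first.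
  by apply/seteqP; split => w; rewrite /= in_itv/= andbT.
rewrite -[_ @^-1` _]setTI; apply: (_ : measurable_fun setT _) => //.
apply: (measurableT_comp (@normr_measurable R setT)).
apply: measurable_funB.
  exact: measurableT_comp (measurable_dist mmX x) mp.
exact: measurableT_comp (measurable_dist mmY y) mq.
Qed.

Lemma measurable_distortion_gap e : measurable (distortion_gap dX dY p q e).
Proof.
rewrite (_ : distortion_gap _ _ _ _ _ = (fun w : W * W =>
    `|dX (p w.1) (p w.2) - dY (q w.1) (q w.2)|) @^-1` `]e, +oo[); last first.
  by apply/seteqP; split => w; rewrite /= in_itv/= andbT.
rewrite -[_ @^-1` _]setTI; apply: (_ : measurable_fun setT _) => //.
apply: (measurableT_comp (@normr_measurable R setT)).
have mpair d' (Z : measurableType d') (h : W -> Z) : measurable_fun setT h ->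
    measurable_fun setT (fun w : W * W => (h w.1, h w.2)).
  move=> mh; apply/measurable_fun_pairP; split.
    exact: measurableT_comp mh measurable_fst.
  exact: measurableT_comp mh measurable_snd.
apply: measurable_funB.
  exact: measurableT_comp (measurable_dist2 mmX) (mpair _ _ _ mp).
exact: measurableT_comp (measurable_dist2 mmY) (mpair _ _ _ mq).
Qed.

Lemma near_marginals : U (marginals mX mY p q).
Proof. by apply: filterS (vanU ltr01) => pi []. Qed.

Lemma near_exists_gap_le x delta : supp dX mX x -> 0 < delta ->
  U [set pi | exists y, (pi (gap x y delta) <= delta%:E)%E].
Proof.
move=> sx d0; have d20 : 0 < delta / 2 by rewrite divr_gt0.
set B := dball dX x (delta / 2); have mB : measurable (p @^-1` B).
  exact: measurable_preimage_dball_l.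
have [c c0 cE] : exists2 c, 0 < c & mX B = c%:E.
  have := sx _ d20; rewrite -/B => B0; exists (fine (mX B)).
    by apply: fine_gt0; rewrite B0/= ltey_eq fin_num_measure//; exact: measurable_dball mmX _ _.
  by rewrite fineK// fin_num_measure//; exact: measurable_dball mmX _ _.
(* Were no [y] suitable, each section of the distortion gap over [B] would have
   mass > delta, and Fubini would give a gap of mass >= delta * c > e. *)
pose e := Num.min (delta / 2) (delta * c / 2).
have e0 : 0 < e by rewrite lt_min d20/= divr_gt0// mulr_gt0.
have e1 : e <= delta / 2 by rewrite ge_min lexx.
have e2 : e < delta * c.
  have : e <= delta * c / 2 by rewrite ge_min lexx orbT.
  have := mulr_gt0 d0 c0; lra.
apply: filterS (vanU e0) => pi [[piX piY]] le_e; apply: contrapT => /forallNP nle.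
move: le_e; apply/negP; rewrite -ltNge.
apply: (@lt_le_trans _ _ (delta * c)%:E); first by rewrite lte_fin.
rewrite EFinM -cE -piX; last exact: measurable_dball mmX _ _.
rewrite -integral_cst//; set E := distortion_gap _ _ _ _ _.
have mE : measurable E by exact: measurable_distortion_gap.
have mxE := measurable_fun_xsection pi mE.
apply: (@le_trans _ _ (\int[pi]_(w in p @^-1` B) (pi \o xsection E) w)%E); last first.
  exact: ge0_subset_integral.
apply: ge0_le_integral => //.
- by move=> w _; rewrite lee_fin ltW.
- exact: measurable_funTS.
(* The candidate is [y = q w]: replacing [x] by [p w] changes distances by less than [delta / 2], so
   the section at [w] contains [gap x (q w) delta]. *)
move=> w Bw /=; apply: (@le_trans _ _ (pi (gap x (q w) delta))).
  by rewrite ltW// ltNge; apply/negP/nle.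
rewrite le_measure ?inE//; [exact: measurable_gap|exact: measurable_xsection|].
move=> w' /=; rewrite /gap/= => gw'; apply/xsectionP; rewrite /E/distortion_gap/=.
apply: le_lt_trans e1 _; move: Bw gw'; rewrite /B/dball/= => Bw.
rewrite !ltNge !ler_norml; apply: contra => /andP[h1 h2].
have := mm_dist_triangle mmX x (p w) (p w').
have := mm_dist_triangle mmX (p w) x (p w').
by rewrite (mm_dist_sym mmX (p w) x) => h3 h4; apply/andP; split; lra.
Qed.

Lemma approx_match x delta : supp dX mX x -> 0 < delta ->
  exists z, U [set pi | (pi (gap x z delta) <= delta%:E)%E].
Proof.
move=> sx d0; pose r := delta / 4; have r0 : 0 < r by rewrite divr_gt0.
have mBX : measurable (dball dX x r) by exact: measurable_dball mmX _ _.
have [c c0 cE] : exists2 c, 0 < c & mX (dball dX x r) = c%:E.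
  have B0 := sx _ r0; exists (fine (mX (dball dX x r))).
    by apply: fine_gt0; rewrite B0/= ltey_eq fin_num_measure.
  by rewrite fineK// fin_num_measure.
pose e := Num.min r (c / 4).
have e0 : 0 < e by rewrite lt_min r0/= divr_gt0.
have er : e <= r by rewrite ge_min lexx.
have ec : e <= c / 4 by rewrite ge_min lexx orbT.
(* Since Y is separable, N balls [C] of radius r carry mass > 1 - c / 2; a good [y]
   must be within 3 r of one of their centres, and [U] selects one centre. *)
have [z dz] := mm_dense_seq mmY.
have mBY n : measurable (dball dY (z n) r) by exact: measurable_dball mmY _ _.
have [N NC] : exists N, ((1 - c / 2)%:E < mY (\bigcup_(i < N) dball dY (z i) r))%E.
  apply: (probability_bigcup_gt mBY).
  rewrite (_ : \bigcup_i _ = setT); last first.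
    by apply/seteqP; split => // y _; have [n zn] := dz y _ r0; exists n.
  by rewrite probability_setT lte_fin; lra.
set C := \bigcup_(i < N) _ in NC; have mC : measurable C by exact: bigcup_measurable.
suff [i _ Ui] : exists2 i, (i < N)%N & U [set pi | (pi (gap x (z i) delta) <= delta%:E)%E].
  by exists (z i).
apply: ultra_bigcup.
apply: filterS (filterI near_marginals (near_exists_gap_le sx e0)).
move=> pi [[piX piY] [y gy]].
have mqC : measurable (q @^-1` (~` C)).
  by rewrite -[_ @^-1` _]setTI; apply: mq => //; exact: measurableC.
have mpB := measurable_preimage_dball_l x r.
have mg := measurable_gap x y e.
(* The excluded sets have mass at most [c / 4] and less than [c / 2], together less than the mass
   [c] of the ball around [x]. *)
have [|w [/= xw /not_orP[gw Cw]]] :=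
  @probability_lt_setD_neq0 _ _ _ pi _ _ mpB (measurableU _ _ mg mqC).
  apply: le_lt_trans (probabilityU2 _ mg mqC) _; rewrite piX// piY//; last exact: measurableC.
  rewrite cE probability_setC//; move: NC gy.
  rewrite -(fineK (fin_num_measure mY _ mC)) -(fineK (fin_num_measure pi _ mg)).
  rewrite -EFinB -EFinD !lee_fin !lte_fin; lra.
move/contrapT: Cw => [i /= iN zw]; exists i => //=.
apply: (@le_trans _ _ (pi (gap x y e))); last first.
  by apply: le_trans gy _; rewrite lee_fin; apply: le_trans er _; rewrite /r; lra.
(* Replacing [y] by [z i] costs less than [3 * r], and [e <= r]; this is why [r = delta / 4]. *)
rewrite le_measure ?inE//; [exact: measurable_gap..|].
move=> w' /=; rewrite /gap/= !ltNge; apply: contra; rewrite !ler_norml => /andP[h1 h2].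
move/negP: gw; rewrite -leNgt ler_norml => /andP[h3 h4].
rewrite /dball/= in xw zw.
have := mm_dist_triangle mmY (z i) y (q w').
have := mm_dist_triangle mmY (z i) (q w) y.
have := mm_dist_triangle mmY y (z i) (q w').
rewrite (mm_dist_sym mmY (q w)) (mm_dist_sym mmY y (z i)) /r in h1 h2 h3 h4 xw zw er *.
by move=> h5 h6 h7; apply/andP; split; lra.
Qed.

(** Some [w] outside both gaps has [p w] within [r] of [x]; then [q w] is within [r + e] of [y] and
    [r + e'] of [y']. This makes approximate matches a Cauchy sequence. *)
Lemma approx_match_dist x y y' e e' r : 0 < e -> 0 < e' ->
  U [set pi | (pi (gap x y e) <= e%:E)%E] -> U [set pi | (pi (gap x y' e') <= e'%:E)%E] ->
  ((e + e')%:E < mX (dball dX x r))%E -> dY y y' <= 2 * r + e + e'.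
Proof.
move=> e0 e'0 Uy Uy' er.
have [pi [[gy gy'] [piX _]]] := filter_ex (filterI (filterI Uy Uy') near_marginals).
have mg := measurable_gap x y e; have mg' := measurable_gap x y' e'.
have mB := measurable_preimage_dball_l x r.
have [|w [/= xw /not_orP[/negP + /negP]]] :=
  @probability_lt_setD_neq0 _ _ _ pi _ _ mB (measurableU _ _ mg mg').
  rewrite piX//; last exact: measurable_dball mmX _ _.
  apply: le_lt_trans er; apply: le_trans (probabilityU2 _ mg mg') _.
  by rewrite EFinD leeD.
rewrite -!leNgt !ler_norml => /andP[h1 h2] /andP[h3 h4]; rewrite /dball/= in xw.
have := mm_dist_triangle mmY y (q w) y'; rewrite (mm_dist_sym mmY (q w)); lra.
Qed.

Lemma exists_match x : supp dX mX x -> exists y, match_ x y.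
Proof.
move=> sx; pose dl n : R := n.+1%:R^-1.
have dl0 n : 0 < dl n by rewrite invr_gt0.
have dl_le m n : (m <= n)%N -> dl n <= dl m.
  by move=> mn; rewrite lef_pV2 ?posrE// ler_nat ltnS.
have /choice[y_ Uy] : forall n, exists z, U [set pi | (pi (gap x z (dl n)) <= (dl n)%:E)%E].
  by move=> n; exact: approx_match.
have [y y_y] : exists y, forall e, 0 < e ->
    exists N, forall n, (N <= n)%N -> dY (y_ n) y < e.
  case: mmY => _ + _ _; apply => e e0.
  have r0 : 0 < e / 8 by rewrite divr_gt0.
  have mB : measurable (dball dX x (e / 8)) by exact: measurable_dball mmX _ _.
  have := sx _ r0; rewrite -(fineK (fin_num_measure mX _ mB)); set c := fine _.
  rewrite lte_fin => c0.
  (* The bound [c / 2] keeps the two gaps below the mass of the ball; the bound [e / 8] keeps the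
     distance below [e / 2]. *)
  have [N] : exists N, dl N < Num.min (e / 8) (c / 2).
    by apply: natSinv_lt; rewrite lt_min r0 divr_gt0.
  rewrite lt_min => /andP[Ne Nc]; exists N => m n Nm Nn.
  have := dl_le _ _ Nm; have := dl_le _ _ Nn => hn hm.
  apply: le_lt_trans (approx_match_dist (dl0 _) (dl0 _) (Uy m) (Uy n) (r := e / 8) _) _.
    by rewrite -(fineK (fin_num_measure mX _ mB)) -/c lte_fin; lra.
  lra.
(* Passing from [y_ n] to the limit costs less than [e / 2], so the gap of [y] at level [e] lies in
   that of [y_ n] at level [dl n < e / 2]. *)
exists y => e e0 e' e'0.
have [N0 N0P] : exists N, dl N < Num.min (e / 2) e'.
  by apply: natSinv_lt; rewrite lt_min e'0 divr_gt0.
have [N1 N1P] := y_y (e / 2) ltac:(by rewrite divr_gt0).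
pose n := maxn N0 N1.
have yn := N1P n (leq_maxr _ _).
have := le_lt_trans (dl_le _ _ (leq_maxl N0 N1)) N0P; rewrite -/n lt_min => /andP[ne ne'].
apply: filterS (Uy n) => pi gn.
apply: le_trans (le_trans gn _); last by rewrite lee_fin ltW.
rewrite le_measure ?inE//; [exact: measurable_gap..|].
move=> w; rewrite /gap/= !ltNge; apply: contra; rewrite !ler_norml => /andP[h1 h2].
have := mm_dist_triangle mmY y (y_ n) (q w); have := mm_dist_triangle mmY (y_ n) y (q w).
by rewrite (mm_dist_sym mmY y (y_ n)) => h3 h4; apply/andP; split; lra.
Qed.

(** Finite unions only, since the rate of decay along [U] may depend on [i]. *)
Lemma asymptotically_null_bigcup N (F : nat -> set W) :
  (forall i, measurable (F i)) -> (forall i, asymptotically_null U (F i)) ->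
  asymptotically_null U (\bigcup_(i < N) F i).
Proof.
move=> mF nF; elim: N => [|N IH] e e0.
  apply: filterS filterT => pi _ /=.
  rewrite (_ : \bigcup_(i < 0) _ = set0) ?measure0 ?lee_fin ?ltW//.
  by apply/seteqP; split => // w [].
have e20 : 0 < e / 2 by rewrite divr_gt0.
apply: filterS (filterI (IH _ e20) (nF N _ e20)) => pi [h1 h2].
rewrite /= bigcup_mkord big_ord_recr/= -bigcup_mkord.
apply: le_trans (probabilityU2 _ _ _) _ => //; first exact: bigcup_measurable.
by rewrite [e in leRHS]splitr EFinD leeD.
Qed.

(** For each [e], one coupling with [pi B <= e] gives [mX A <= mY C + e]; the marginals do not
    depend on the coupling, so [e] can tend to 0. *)
Lemma marginal_le (A : set X) (C : set Y) (B : set W) :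
  measurable A -> measurable C -> measurable B -> asymptotically_null U B ->
  p @^-1` A `<=` q @^-1` C `|` B -> (mX A <= mY C)%E.
Proof.
move=> mA mC mB nB ACB; apply/lee_addgt0Pr => e e0.
have [pi [Be [piX piY]]] := filter_ex (filterI (nB e e0) near_marginals).
have mpA : measurable (p @^-1` A) by rewrite -[_ @^-1` _]setTI; exact: mp.
have mqC : measurable (q @^-1` C) by rewrite -[_ @^-1` _]setTI; exact: mq.
rewrite -piX// -piY//; apply: (@le_trans _ _ (pi (q @^-1` C `|` B))).
  by rewrite le_measure ?inE//; exact: measurableU.
by apply: le_trans (probabilityU2 _ mqC mB) _; rewrite leeD2l.
Qed.

(** Take [w] outside both gaps with [p w] within [e / 4] of [x']; then [q w] is within [e / 2] of
    [y'], and the errors add up to [e]. The case [x = x'] gives uniqueness of the match. *)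
Lemma match_dist x x' y y' : supp dX mX x' -> match_ x y -> match_ x' y' ->
  dY y y' = dX x x'.
Proof.
move=> sx' xy xy'; apply/eqP; rewrite -subr_eq0 -normr_le0; apply/ler_addgt0Pr => e e0.
have e40 : 0 < e / 4 by rewrite divr_gt0.
have mB : measurable (dball dX x' (e / 4)) by exact: measurable_dball mmX _ _.
have := sx' _ e40; rewrite -(fineK (fin_num_measure mX _ mB)); set c := fine _.
rewrite lte_fin => c0; have c40 : 0 < c / 4 by rewrite divr_gt0.
have [pi [[gy gy'] [piX _]]] :=
  filter_ex (filterI (filterI (xy _ e40 _ c40) (xy' _ e40 _ c40)) near_marginals).
have mg := measurable_gap x y (e / 4); have mg' := measurable_gap x' y' (e / 4).
have mpB := measurable_preimage_dball_l x' (e / 4).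
have [|w [/= xw /not_orP[/negP + /negP]]] :=
  @probability_lt_setD_neq0 _ _ _ pi _ _ mpB (measurableU _ _ mg mg').
  rewrite piX//; apply: (@le_lt_trans _ _ (c / 4 + c / 4)%:E).
    by apply: le_trans (probabilityU2 _ mg mg') _; rewrite EFinD leeD.
  by rewrite -(fineK (fin_num_measure mX _ mB)) -/c lte_fin; lra.
rewrite -!leNgt !ler_norml => /andP[h1 h2] /andP[h3 h4]; rewrite /dball/= in xw.
have := mm_dist_triangle mmY y (q w) y'.
have := mm_dist_triangle mmY y y' (q w).
have := mm_dist_triangle mmX x (p w) x'.
have := mm_dist_triangle mmX x x' (p w).
rewrite (mm_dist_sym mmY (q w) y') (mm_dist_sym mmX (p w) x') add0r => h5 h6 h7 h8.
by apply/andP; split; lra.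
Qed.

(** Outside a gap of level [r / 4], the ball of radius [r / 2] around [x] is sent into the ball of
    radius [r] around [y]. *)
Lemma match_supp x y : match_ x y -> supp dX mX x -> supp dY mY y.
Proof.
move=> xy sx r r0; have r20 : 0 < r / 2 by rewrite divr_gt0.
have r40 : 0 < r / 4 by rewrite divr_gt0.
apply: lt_le_trans (sx _ r20) _.
apply: (marginal_le (measurable_dball mmX _ _) (measurable_dball mmY _ _)
  (measurable_gap x y (r / 4)) (xy _ r40)) => w /= xw.
apply/or_asboolP; rewrite orbC -implyNb; apply/implyP => /asboolPn/negP.
rewrite -leNgt ler_norml => /andP[h1 h2]; apply/asboolP; move: xw.
rewrite /dball/=; lra.
Qed.

Lemma measure_dopen_le (V : set X) (O : set Y) : dopen dX V -> dopen dY O ->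
  (forall x y, supp dX mX x -> V x -> match_ x y -> O y) -> (mX V <= mY O)%E.
Proof.
move=> oV oO VO; have mV := measurable_dopen mmX oV; have mO := measurable_dopen mmY oO.
rewrite -(measure_setI_supp mmX mV).
have [->|/set0P SV0] := eqVneq (supp dX mX `&` V) set0; first by rewrite measure0.
(* The factor 2 pays for a ball of radius [yr.2] around [x] and a gap of the same level. *)
have /choice[f fP] : forall x, exists yr : Y * R, supp dX mX x /\ V x ->
    [/\ match_ x yr.1, 0 < yr.2 & dball dY yr.1 (2 * yr.2) `<=` O].
  move=> x; have [[sx Vx]|nx] := pselect (supp dX mX x /\ V x); last by exists (point, 0).
  have [y xy] := exists_match sx; have [r r0 rO] := oO _ (VO _ _ sx Vx xy).
  by exists (y, r / 2) => _; split; rewrite ?divr_gt0//= mulrC divfK.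
have [x /fP[]//|u [uS Sc]] := lindelof_dball mmX SV0 (rho := fun x => (f x).2).
pose F n := dball dX (u n) (f (u n)).2; pose G n := dball dY (f (u n)).1 (2 * (f (u n)).2).
have mF n : measurable (F n) by exact: measurable_dball mmX _ _.
have mG n : measurable (G n) by exact: measurable_dball mmY _ _.
have mUF := bigcupT_measurable _ mF; have mUG := bigcupT_measurable _ mG.
apply: (@le_trans _ _ (mX (\bigcup_n F n))).
  by rewrite le_measure ?inE//; apply: measurableI mV; exact: measurable_supp mmX.
apply: (@le_trans _ _ (mY (\bigcup_n G n))); last first.
  by rewrite le_measure ?inE//; apply: bigcup_sub => n _; case: (fP _ (uS n)).
(* Continuity from below cuts the cover to [N] balls, for which the union of the gaps is still
   asymptotically null. *)
rewrite leNgt; apply/negP => /(probability_bigcup_gt mF)[N]; apply/negP; rewrite -leNgt.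
apply: (@le_trans _ _ (mY (\bigcup_(i < N) G i))); last first.
  rewrite le_measure ?inE//; first exact: bigcup_measurable.
  by move=> y [i _ Gi]; exists i.
pose B n := gap (u n) (f (u n)).1 (f (u n)).2.
have mB n : measurable (B n) by exact: measurable_gap.
have nB n : asymptotically_null U (B n).
  by have [h r0 _] := fP _ (uS n); exact: h.
apply: (marginal_le _ _ _ (asymptotically_null_bigcup N mB nB)); [exact: bigcup_measurable..|].
move=> w [i /= iN Fi]; have [/negP|Bi] := pselect (~ B i w); last first.
  by right; exists i => //; exact: contrapT.
rewrite -leNgt ler_norml => /andP[h1 h2]; left; exists i => //.
by move: Fi; rewrite /F /G /dball/=; lra.
Qed.

End matching.

(** * From vanishing distance to an isomorphism *)

Lemma d_Eur_lt (R : realType) dx dy (X : measurableType dx) (Y : measurableType dy)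
    (dX : X -> X -> R) (mX : probability X R) (dY : Y -> Y -> R) (mY : probability Y R)
    (e : R) :
  is_mm_space dX mX -> is_mm_space dY mY -> (d_Eur dX mX dY mY < e%:E)%E ->
  exists2 pi, couplings mX mY pi & (product_measure1 pi pi (dist_gap dX dY e) <= e%:E)%E.
Proof.
move=> mmX mmY /ereal_inf_lt[_ [pi [eps [cpi eps0 ->]]]].
rewrite gt_max lte_fin => /andP[epse lte]; exists pi => //.
apply: le_trans (ltW lte).
have mgap := measurable_distortion_gap mmX mmY measurable_fst measurable_snd.
rewrite le_measure ?inE//; [exact: mgap..|].
by move=> w /=; exact: lt_trans.
Qed.

Lemma vanishing_distortion_exists (R : realType) dx dy
    (X : measurableType dx) (Y : measurableType dy)
    (dX : X -> X -> R) (mX : probability X R) (dY : Y -> Y -> R) (mY : probability Y R) :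
  is_mm_space dX mX -> is_mm_space dY mY -> d_Eur dX mX dY mY = 0%E ->
  exists2 U : set_system (probability (X * Y)%type R), UltraFilter U &
    vanishing_distortion dX mX dY mY fst snd U.
Proof.
move=> mmX mmY d0.
pose B e := [set pi : probability (X * Y)%type R | marginals mX mY fst snd pi /\
  (product_measure1 pi pi (distortion_gap dX dY fst snd e) <= e%:E)%E].
have B0 e : 0 < e -> B e !=set0.
  move=> e0; have [|pi [piX piY] pie] := @d_Eur_lt R _ _ X Y dX mX dY mY e mmX mmY.
    by rewrite d0 lte_fin.
  exists pi; split => //; split => [A mA|C mC].
    by rewrite -piX//; congr (pi _); apply/seteqP; split => // -[x y] [].
  by rewrite -piY//; congr (pi _); apply/seteqP; split => // -[x y] [].
have mgap := measurable_distortion_gap mmX mmY measurable_fst measurable_snd.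
(* A larger [e] shrinks the gap set and weakens the bound, so the sets [B e] are nested and form a
   filter base. *)
have BS e e' : e <= e' -> B e `<=` B e'.
  move=> ee' pi [mpi pie]; split => //.
  apply: le_trans (le_trans pie _); last by rewrite lee_fin.
  by rewrite le_measure ?inE//; [exact: mgap..|move=> w /=; exact: le_lt_trans].
have FB : ProperFilter (filter_from [set e : R | 0 < e] B).
  apply: filter_from_proper => //; apply: filter_from_filter; first by exists 1 => /=.
  move=> e e' /= e0 e'0; exists (Num.min e e'); first by rewrite /= lt_min e0.
  by move=> pi Bpi; split; apply: BS Bpi; rewrite ge_min lexx ?orbT.
have [U [UU FU]] := ultraFilterLemma FB; exists U => // e e0.
by apply: FU; exists e.
Qed.

Theorem theorem7p6 (R : realType) (dx dy : measure_display)
  (X : measurableType dx) (Y : measurableType dy)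
  (dX : X -> X -> R) (mX : probability X R)
  (dY : Y -> Y -> R) (mY : probability Y R) :
  is_mm_space dX mX -> is_mm_space dY mY ->
  d_Eur dX mX dY mY = 0%E ->
  mm_isomorphic dX mX dY mY.
Proof.
move=> mmX mmY /(vanishing_distortion_exists mmX mmY)[U UU vanU].
have mfst := @measurable_fst _ _ X Y; have msnd := @measurable_snd _ _ X Y.
have vanUC : vanishing_distortion dY mY dX mX snd fst U by exact: vanishing_distortionC.
(* The constant value [point] off the support makes [f] measurable there. *)
have /choice[f fP] : forall x, exists y, if `[< supp dX mX x >]
    then asymptotic_match dX dY fst snd U x y else y = point.
  move=> x; case: asboolP => [sx|_]; last by exists point.
  exact: (exists_match mmX mmY mfst msnd UU vanU).
have fM x : supp dX mX x -> asymptotic_match dX dY fst snd U x (f x).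
  by move=> sx; have := fP x; rewrite asboolT.
have f_dist x x' : supp dX mX x -> supp dX mX x' -> dY (f x) (f x') = dX x x'.
  by move=> sx sx'; apply: (match_dist mmX mmY mfst msnd UU vanU) => //; exact: fM.
have f_uniq x y : supp dX mX x -> asymptotic_match dX dY fst snd U x y -> f x = y.
  move=> sx xy; apply: (mm_dist_eq0 mmY).
  by rewrite (match_dist mmX mmY mfst msnd UU vanU sx (fM _ sx) xy) (mm_dist_xx mmX).
have f_supp x : supp dX mX x -> supp dY mY (f x).
  by move=> sx; apply: (match_supp mmX mmY mfst msnd UU vanU (fM _ sx)).
(* The preimage of [O] under [f] need not be open, but it has the same trace on the support as the
   open set [V], a union of balls around support points. *)
have f_open O : dopen dY O -> exists V, [/\ dopen dX V,
    supp dX mX `&` f @^-1` O = supp dX mX `&` V & mX V = mY O].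
  move=> oO; pose V := [set x' | exists x r, [/\ supp dX mX x, 0 < r,
    dball dY (f x) r `<=` O & dball dX x r x']].
  have VE x : supp dX mX x -> V x <-> O (f x).
    move=> sx; split => [[x' [r [sx' r0 rO xr]]]|/oO[r r0 rO]].
      by apply: rO; rewrite /dball/= f_dist.
    by exists x, r; split => //; rewrite /dball/= (mm_dist_xx mmX).
  have oV : dopen dX V.
    move=> y [x [r [sx r0 rO xy]]]; have [s s0 sr] := dopen_dball mmX xy.
    by exists s => // z /sr xz; exists x, r.
  exists V; split => //.
    by apply/seteqP; split => x [sx /(VE _ sx)].
  (* One inequality per direction of the matching. *)
  apply/eqP; rewrite eq_le; apply/andP; split.
    apply: (measure_dopen_le mmX mmY mfst msnd UU vanU oV oO) => x y sx Vx xy.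
    by rewrite -(f_uniq x y)//; apply/VE.
  apply: (measure_dopen_le mmY mmX msnd mfst UU vanUC oO oV) => y x sy Oy yx.
  have sx := match_supp mmY mmX msnd mfst UU vanUC yx sy.
  by apply/VE => //; rewrite (f_uniq x y)//; exact: asymptotic_matchC.
have mS := measurable_supp mmX.
have mf : measurable_fun setT f.
  case: (mmY) => _ _ _ mYE; apply: (measurability _ mYE) => _ [A oA <-].
  rewrite setTI; have [V [oV fAV _]] := f_open _ oA.
  rewrite -[f @^-1` A]setTI -(setUv (supp dX mX)) setIUl fAV.
  apply: measurableU; first exact: measurableI (measurable_dopen mmX oV).
  have f_out x : ~ supp dX mX x -> f x = point.
    by move=> nsx; have := fP x; rewrite asboolF.
  have [Ap|nAp] := pselect (A point).
    rewrite (_ : _ `&` _ = ~` supp dX mX); first exact: measurableC.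
    by apply/seteqP; split => [x []//|x nsx]; split => //=; rewrite f_out.
  rewrite (_ : _ `&` _ = set0); first exact: measurable0.
  by apply/seteqP; split => // x [nsx /=]; rewrite f_out.
have f_push A : dopen dY A -> mY A = mX (f @^-1` A).
  move=> oA; have [V [oV fAV <-]] := f_open _ oA.
  rewrite -(measure_setI_supp mmX (measurable_dopen mmX oV)) -fAV (measure_setI_supp mmX)//.
  by rewrite -[_ @^-1` _]setTI; exact: (mf measurableT _ (measurable_dopen mmY oA)).
exists f; split => //.
  apply/seteqP; split => [_ [x sx <-]|y sy]; first exact: f_supp.
  have [x yx] := exists_match mmY mmX msnd mfst UU vanUC sy.
  have sx := match_supp mmY mmX msnd mfst UU vanUC yx sy.
  by exists x => //; apply: f_uniq => //; exact: asymptotic_matchC.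
move=> B mB; rewrite (measure_setI_supp mmX); last by rewrite -[_ @^-1` _]setTI; exact: mf.
case: (mmY) => _ _ _ mYE.
have dopenT : dopen dY setT by move=> y _; exists 1.
pose nu := distribution mX (mfun_Sub (mem_set mf) : {mfun X >-> Y}).
(* Open sets are stable under intersection and generate the sigma-algebra, so agreement on them
   extends to [B]. *)
apply: (measure_unique [set A | dopen dY A] (fun=> setT) mYE _ _ _ mY nu) => //.
- move=> A A' oA oA' y [Ay A'y]; have [r r0 rA] := oA y Ay; have [r' r'0 rA'] := oA' y A'y.
  exists (Num.min r r'); first by rewrite lt_min r0.
  by move=> z; rewrite /dball/= lt_min => /andP[zr zr']; split; [exact: rA|exact: rA'].
- by apply/seteqP; split => // y _; exists 0%N.
- by move=> _; rewrite [ltLHS]probability_setT ltry.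
Qed.
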